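(* Let $A\in\operatorname{SpS}(2n)$, and let $\Pi_-,\Pi_0,\Pi_+$ be symplectic orthogonal projections (real $2n\times 2n$ matrices) satisfying (i) $\Pi_-\Pi_0=\Pi_-\Pi_+=\Pi_0\Pi_+=0$ and $\Pi_-+\Pi_0+\Pi_+=I_{2n}$; (ii) $A=\Pi_-^{\top}A\Pi_-+\Pi_+^{\top}A\Pi_+$; (iii) $\Pi_-^{\top}A\Pi_-$ is negative definite on $\operatorname{range}(\Pi_-)$ and $\Pi_+^{\top}A\Pi_+$ is positive definite on $\operatorname{range}(\Pi_+)$. Then $A$ has $\frac12\operatorname{rank}(\Pi_0)$ zero symplectic eigenvalues. The negative symplectic eigenvalues of $A$ are the negative eigenvalues of the Hermitian matrix $i\left(-\Pi_-^{\top}A\Pi_-\right)^{1/2}J\left(-\Pi_-^{\top}A\Pi_-\right)^{1/2}$, and the positive symplectic eigenvalues of $A$ are the positive eigenvalues of the Hermitian matrix $i\left(\Pi_+^{\top}A\Pi_+\right)^{1/2}J\left(\Pi_+^{\top}A\Pi_+\right)^{1/2}$ (all counted with multiplicity).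
   Context: $J=J_{2n}=\begin{pmatrix}0&I_n\\-I_n&0\end{pmatrix}$, $i=\sqrt{-1}$, and $\langle x,y\rangle=x^{\top}y$. $\operatorname{Sp}(2n)$ is the set of $2n\times 2n$ real matrices $M$ with $M^{\top}JM=J$. For a subset $\mathscr{X}\subseteq\mathbb{R}^{2n}$, $\mathscr{X}^{\perp_{\operatorname{s}}}=\{u\in\mathbb{R}^{2n}:\langle u,Jv\rangle=0\ \forall v\in\mathscr{X}\}$. A linear subspace $\mathscr{W}$ is a symplectic subspace if $\mathscr{W}\cap\mathscr{W}^{\perp_{\operatorname{s}}}=\{0\}$ (the zero subspace is allowed); then $\mathbb{R}^{2n}=\mathscr{W}\oplus\mathscr{W}^{\perp_{\operatorname{s}}}$. Symplectic subspaces $\mathscr{W},\mathscr{Z}$ are symplectically orthogonal to each other if $\mathscr{Z}\subseteq\mathscr{W}^{\perp_{\operatorname{s}}}$. The symplectic orthogonal projection onto a symplectic subspace $\mathscr{W}$ is the $2n\times 2n$ real matrix $\Pi$ with $\Pi x=x$ for $x\in\mathscr{W}$ and $\Pi x=0$ for $x\in\mathscr{W}^{\perp_{\operatorname{s}}}$; a symplectic orthogonal projection is a matrix of this form for some symplectic subspace. A symmetric matrix $A$ is positive definite on a subspace $\mathscr{W}$ if $\langle w,Aw\rangle>0$ for all nonzero $w\in\mathscr{W}$, and negative definite on $\mathscr{W}$ if $-A$ is positive definite there. $\nu(A),\xi(A),\pi(A)$ denote the numbers of negative, zero, and positive eigenvalues of $A$ (with multiplicity). For a positive semidefinite matrix $B$,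 $B^{1/2}$ is its unique positive semidefinite square root; the matrices $-\Pi_-^{\top}A\Pi_-$ and $\Pi_+^{\top}A\Pi_+$ are positive semidefinite. $\operatorname{SpS}(2n)$ is the set of $2n\times 2n$ real symmetric matrices $A$ for which there exist pairwise symplectically orthogonal symplectic subspaces $\mathscr{W}_-,\mathscr{W}_0,\mathscr{W}_+$ of $\mathbb{R}^{2n}$ with dimensions $\nu(A),\xi(A),\pi(A)$, respectively, such that each of them is invariant under $JA$, $A$ is negative definite on $\mathscr{W}_-$, $\ker(A)=\mathscr{W}_0$, and $A$ is positive definite on $\mathscr{W}_+$. For $A\in\operatorname{SpS}(2n)$ there exist $M\in\operatorname{Sp}(2n)$ and an $n\times n$ real diagonal matrix $D$, unique up to ordering of its diagonal entries, with $M^{\top}AM=D\oplus D$; the $n$ diagonal entries of $D$ are called the symplectic eigenvalues of $A$. *)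

(* Defs.v *)
From mathcomp Require Import all_boot all_order all_algebra.
From mathcomp Require Import boolp classical_sets reals complex.

Set Implicit Arguments.
Unset Strict Implicit.
Unset Printing Implicit Defensive.

Import Order.TTheory GRing.Theory Num.Theory.
Local Open Scope classical_set_scope.
Local Open Scope ring_scope.
Local Open Scope complex_scope.

Section Definiteness.
Context {R : realType}.

Definition dotv m (x y : 'cV[R]_m) : R := (x^T *m y) 0 0.

Definition posdef_on m (A : 'M[R]_m) (W : set 'cV[R]_m) : Prop :=
  forall w, W w -> w != 0 -> 0 < dotv w (A *m w).

Definition negdef_on m (A : 'M[R]_m) (W : set 'cV[R]_m) : Prop :=
  posdef_on (- A) W.

Definition psdmx m (B : 'M[R]_m) : Prop :=
  B^T = B /\ forall x, 0 <= dotv x (B *m x).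

(* Meaningful only for positive semidefinite B (the value is 0 otherwise). *)
Definition psdsqrt m (B : 'M[R]_m) : 'M[R]_m :=
  xget 0 [set S | psdmx S /\ S *m S = B].

End Definiteness.

Section Spectrum.

(* All complex roots of the characteristic polynomial, listed with algebraic
   multiplicity; the order of the list is irrelevant. *)
Definition eigenvalues (R : realType) m (M : 'M[R[i]]_m) : seq R[i] :=
  sval (closed_field_poly_normal (char_poly M)).

Definition complexmx (R : realType) m (A : 'M[R]_m) : 'M[R[i]]_m :=
  map_mx (real_complex R) A.

(* The order of R[i] only compares numbers with the same imaginary part, so
   [z < 0] says that z is real and negative. *)
Definition nneg_eig (R : realType) m (A : 'M[R]_m) : nat :=
  count (fun z => z < 0) (eigenvalues (complexmx A)).

Definition nzero_eig (R : realType) m (A : 'M[R]_m) : nat :=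
  count (fun z => z == 0) (eigenvalues (complexmx A)).

Definition npos_eig (R : realType) m (A : 'M[R]_m) : nat :=
  count (fun z => 0 < z) (eigenvalues (complexmx A)).

End Spectrum.

Section Symplectic.
Context {R : realType}.

Definition sympJ n : 'M[R]_(n + n) := block_mx 0 1%:M (- 1%:M) 0.

Definition symplecticmx n (M : 'M[R]_(n + n)) : Prop :=
  M^T *m sympJ n *m M = sympJ n.

Definition sympl_compl n (X : set 'cV[R]_(n + n)) : set 'cV[R]_(n + n) :=
  [set u | forall v, X v -> dotv u (sympJ n *m v) = 0].

Definition symplectic_subspace n (W : {vspace 'cV[R]_(n + n)}) : Prop :=
  [set` W] `&` sympl_compl [set` W] = [set 0].

Definition sympl_orthogonal n (W Z : {vspace 'cV[R]_(n + n)}) : Prop :=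
  [set` Z] `<=` sympl_compl [set` W].

Definition sympl_projection n (P : 'M[R]_(n + n)) : Prop :=
  exists W : {vspace 'cV[R]_(n + n)},
    [/\ symplectic_subspace W,
        forall x, x \in W -> P *m x = x
      & forall x, sympl_compl [set` W] x -> P *m x = 0].

Definition invariant_under m (B : 'M[R]_m) (W : {vspace 'cV[R]_m}) : Prop :=
  forall x, x \in W -> B *m x \in W.

Definition SpS n (A : 'M[R]_(n + n)) : Prop :=
  A^T = A /\
  exists Wm W0 Wp : {vspace 'cV[R]_(n + n)},
  [/\ [/\ symplectic_subspace Wm, symplectic_subspace W0
        & symplectic_subspace Wp],
      [/\ sympl_orthogonal Wm W0, sympl_orthogonal Wm Wp
        & sympl_orthogonal W0 Wp],
      [/\ \dim Wm = nneg_eig A, \dim W0 = nzero_eig A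
        & \dim Wp = npos_eig A],
      [/\ invariant_under (sympJ n *m A) Wm,
          invariant_under (sympJ n *m A) W0
        & invariant_under (sympJ n *m A) Wp]
    & [/\ negdef_on A [set` Wm],
          [set x | A *m x = 0] = [set` W0]
        & posdef_on A [set` Wp]]].

(* [d] lists the symplectic eigenvalues of A.  For A in SpS such a d exists and
   is unique up to the order of its entries. *)
Definition symplectic_eigenvalues n (A : 'M[R]_(n + n)) (d : 'rV[R]_n) : Prop :=
  exists M : 'M[R]_(n + n),
    symplecticmx M /\
    M^T *m A *m M = block_mx (diag_mx d) 0 0 (diag_mx d).

Definition mxrange m (P : 'M[R]_m) : set 'cV[R]_m := range (mulmx P).

(* The Hermitian matrix i B^(1/2) J B^(1/2). *)
Definition iSJS n (B : 'M[R]_(n + n)) : 'M[R[i]]_(n + n) :=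
  'i *: complexmx (psdsqrt B *m sympJ n *m psdsqrt B).

End Symplectic.

Arguments sympJ {R} n.

(* Main.v *)
Require Import Defs.
From mathcomp Require Import all_boot all_order all_algebra.
From mathcomp Require Import zify.
From mathcomp Require Import boolp classical_sets reals complex.

Import Order.TTheory GRing.Theory Num.Theory.
Local Open Scope ring_scope.
Local Open Scope complex_scope.
Local Open Scope sesquilinear_scope.

Set Implicit Arguments.
Unset Strict Implicit.
Unset Printing Implicit Defensive.

(** Put B+ = Pp^T A Pp, B- = - Pm^T A Pm and K = iJ, a Hermitian matrix.  Both
    B+ and B- are positive semidefinite, A = B+ - B-, and B+ J B- = 0 because
    the projections are symplectically orthogonal to each other.  With the
    square roots F of B+ and G of B-, the Hermitian matrix A is thus written
    A = F F^* - G G^* with F^* K G = 0 ([signed_splitting]), and the matrices of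
    the theorem are F^* K F and G^* K G.

    The decomposition of A into such a pair is not unique, since JA may have a
    double eigenvalue on which A is indefinite.  The nonzero spectrum of
    F^* K F nevertheless depends on A and K only ([rank_eigenspace_le], used in
    both directions).  Multiplication by F^* K embeds the eigenspace of F^* K F
    for lam into the eigenspace E of AK for lam, and the Hermitian form of A is
    positive definite on the image.  In the same way the eigenspace of G^* K G
    for - lam is embedded in E as a subspace on which A is negative definite,
    and the two images span E.  As in Sylvester's law of inertia, the positive
    space of one decomposition meets the negative space of another one
    trivially, so the dimensions agree.

    A second decomposition comes from M^T A M = D + D (direct sum): a matrix
    with orthogonal columns diagonalizes K, is compatible with the block
    scalar structure of D + D, and so yields factors F', G' for which F'^* K F'
    and G'^* K G' are diagonal with entries +- max(d, 0) and +- max(- d, 0)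
    ([williamson_splitting], [williamson_factor_form]).  Comparing the two
    decompositions gives the claims about the signed symplectic eigenvalues,
    because for a Hermitian matrix the multiplicity of an eigenvalue is the
    dimension of its eigenspace ([count_eigenvalues]).

    For the zero symplectic eigenvalues, definiteness of A on the ranges of Pm
    and Pp makes the kernel of A equal to the range of P0
    ([rank_sympl_projection_ker]), while the rank of A is twice the number of
    nonzero entries of D. *)

(** * Inertia of a Hermitian matrix on an eigenspace *)

Lemma adjmxM (C : numClosedFieldType) m n p (A : 'M[C]_(m, n))
    (B : 'M[C]_(n, p)) : (A *m B)^t* = B^t* *m A^t*.
Proof. by rewrite trmx_mul map_mxM. Qed.

Lemma mulmx_adj_ge0 {C : numClosedFieldType} {n : nat} (q : 'rV[C]_n) :
  0 <= (q *m q^t*) 0 0.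
Proof.
rewrite -dotmxE; have [->|/dotmx_is_dotmx/ltW//] := eqVneq q 0.
by rewrite dotmxE mul0mx mxE.
Qed.

Lemma mulmx_adj_eq0 {C : numClosedFieldType} {n : nat} (q : 'rV[C]_n) :
  (q *m q^t*) 0 0 = 0 -> q = 0.
Proof.
move=> q0; apply/eqP; apply: contra_eqT q0 => /dotmx_is_dotmx.
by rewrite dotmxE => /lt0r_neq0.
Qed.

Lemma mxrank_mul_inj (F : fieldType) m n p (A : 'M[F]_(m, n))
    (B : 'M[F]_(n, p)) :
  (forall x : 'rV_n, (x <= A)%MS -> x *m B = 0 -> x = 0) ->
  \rank (A *m B) = \rank A.
Proof.
move=> injB; apply/mxrank_injP/eqP/eqP/rowV0P => x.
by rewrite sub_capmx => /andP[xA /sub_kermxP]; apply: injB.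
Qed.

(** The term F F^* carries the positive part of the Hermitian matrix A and
    G G^* the negative part; F^* K G = 0 says that the two parts do not interact
    under multiplication by K. *)
Definition signed_splitting {C : numClosedFieldType} {n k l : nat}
    (A K : 'M[C]_n) (F : 'M[C]_(n, k)) (G : 'M[C]_(n, l)) : Prop :=
  A = F *m F^t* - G *m G^t* /\ F^t* *m K *m G = 0.

Lemma signed_splittingN {C : numClosedFieldType} {n k l : nat} (A K : 'M[C]_n)
    (F : 'M[C]_(n, k)) (G : 'M[C]_(n, l)) :
  K^t* = K -> signed_splitting A K F G -> signed_splitting (- A) K G F.
Proof.
move=> hK [-> FKG]; split; first by rewrite opprB.
have := congr1 (fun X : 'M_(k, l) => X^t*) FKG.
by rewrite !adjmxM trmxCK hK mulmxA trmx0 map_mx0.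
Qed.

Section Lift.
Context {C : numClosedFieldType} {n k l : nat}.
Context {A K : 'M[C]_n} {F : 'M[C]_(n, k)} {G : 'M[C]_(n, l)}.
Hypothesis spl : signed_splitting A K F G.

(** Right multiplication by F^* K turns the action of F^* K F into the action
    of AK: the contribution of G disappears since F^* K G = 0. *)
Lemma lift_mulmx m (q : 'M_(m, k)) :
  q *m (F^t* *m K) *m A = q *m (F^t* *m K *m F) *m F^t*.
Proof.
have [-> FKG] := spl; rewrite mulmxBr -[X in _ - X]mulmxA.
by rewrite [_ *m (G *m _)]mulmxA FKG mul0mx mulmx0 subr0 !mulmxA.
Qed.

Lemma lift_eigenspace_sub (lam : C) :
  (eigenspace (F^t* *m K *m F) lam *m (F^t* *m K) <= eigenspace (A *m K) lam)%MS.
Proof.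
apply/eigenspaceP; rewrite mulmxA lift_mulmx.
have /eigenspaceP -> : (eigenspace (F^t* *m K *m F) lam
  <= eigenspace (F^t* *m K *m F) lam)%MS by [].
by rewrite -!scalemxAl !mulmxA.
Qed.

(** For x = q F^* K with q an eigenvector, x A x^* is the squared norm of
    q F^* K F = lam q.  So A is positive definite on the lifted eigenspace. *)
Lemma lift_eigenspace_form (lam : C) (q : 'rV_k) : K^t* = K ->
  q *m (F^t* *m K *m F) = lam *: q ->
  (q *m (F^t* *m K)) *m A *m (q *m (F^t* *m K))^t* =
  (`|lam| ^+ 2) *: (q *m q^t*).
Proof.
move=> hK eq; rewrite lift_mulmx eq -scalemxAl.
have e2 : F^t* *m (q *m (F^t* *m K))^t* = (lam^*)%R *: q^t*.
  rewrite -(map_mxZ Num.conj) -linearZ /= -eq.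
  by rewrite !adjmxM trmxCK hK !mulmxA.
by rewrite -scalemxAl -mulmxA e2 -scalemxAr scalerA normCK.
Qed.

(** Right multiplication by F is, up to the factor lam, the inverse of the
    lift: it sends eigenvectors of AK to eigenvectors of F^* K F. *)
Lemma restrict_eigenspace_sub m (E : 'M_(m, n)) (lam : C) : K^t* = K ->
  E *m (A *m K) = lam *: E ->
  (E *m F <= eigenspace (F^t* *m K *m F) lam)%MS.
Proof.
move=> hK EAK; apply/eigenspaceP; rewrite scalemxAl -EAK.
have [_ GKF] := signed_splittingN hK spl; have [-> _] := spl.
have -> : (F *m F^t* - G *m G^t*) *m K = F *m (F^t* *m K) - G *m (G^t* *m K).
  by rewrite mulmxBl !mulmxA.
rewrite mulmxBr mulmxBl -[X in _ = _ - X]mulmxA -[G *m _ *m F]mulmxA GKF.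
by rewrite !mulmx0 subr0 !mulmxA.
Qed.

End Lift.

(** Sylvester's argument inside the eigenspace E of AK: the positive space
    lifted from F and the negative space lifted from G' are disjoint in E, and E
    is spanned by the spaces lifted from F' and G'. *)
Lemma rank_eigenspace_le {C : numClosedFieldType} {n k l k' l' : nat}
    {A K : 'M[C]_n} {F : 'M[C]_(n, k)} {G : 'M[C]_(n, l)}
    {F' : 'M[C]_(n, k')} {G' : 'M[C]_(n, l')} (lam : C) :
  K^t* = K -> lam != 0 ->
  signed_splitting A K F G -> signed_splitting A K F' G' ->
  (\rank (eigenspace (F^t* *m K *m F) lam)
    <= \rank (eigenspace (F'^t* *m K *m F') lam))%N.
Proof.
move=> hK lam0 spl spl'.
have splN' := signed_splittingN hK spl'.
set VF := eigenspace _ _; set VF' := eigenspace (F'^t* *m _ *m _) _.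
(* By symmetry G' plays the part of F' for - A, hence for the eigenvalue - lam. *)
pose VG' := eigenspace (G'^t* *m K *m G') (- lam).
pose E := eigenspace (A *m K) lam.
have sN' : (VG' *m (G'^t* *m K) <= E)%MS.
  have := lift_eigenspace_sub splN' (- lam).
  by move/eigenspaceP=> h; apply/eigenspaceP; move: h; rewrite mulNmx mulmxN
     scaleNr => /oppr_inj.
have rF : \rank (VF *m (F^t* *m K)) = \rank VF.
  apply: mxrank_mul_inj => x /eigenspaceP; rewrite mulmxA => ex x0.
  move: ex; rewrite x0 mul0mx => /esym/eqP.
  by rewrite scaler_eq0 (negPf lam0) => /eqP.
have rG' : \rank (VG' *m (G'^t* *m K)) = \rank VG'.
  apply: mxrank_mul_inj => x /eigenspaceP; rewrite mulmxA => ex x0.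
  move: ex; rewrite x0 mul0mx => /esym/eqP.
  by rewrite scaler_eq0 oppr_eq0 (negPf lam0) => /eqP.
(* On a common vector the form of A is both nonnegative and nonpositive. *)
have disj : (VF *m (F^t* *m K) :&: VG' *m (G'^t* *m K))%MS = 0.
  apply/eqP/rowV0P => x; rewrite sub_capmx => /andP[/submxP[u ->]].
  rewrite mulmxA; set q := u *m VF => /submxP[v]; rewrite mulmxA.
  set r := v *m VG' => eqr.
  have qV : q *m (F^t* *m K *m F) = lam *: q.
    by apply/eigenspaceP; rewrite submxMl.
  have rV : r *m (G'^t* *m K *m G') = - lam *: r.
    by apply/eigenspaceP; rewrite submxMl.
  have := lift_eigenspace_form splN' hK rV.
  rewrite -eqr mulmxN mulNmx (lift_eigenspace_form spl hK qV).
  move=> /(congr1 (fun X : 'M_1 => X 0 0)).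
  rewrite [LHS]mxE [X in - X]mxE [RHS]mxE normrN => e.
  have l2 : 0 < `|lam| ^+ 2 by rewrite exprn_gt0 ?normr_gt0.
  have := mulmx_adj_ge0 r; rewrite -(pmulr_rge0 _ l2) -e oppr_ge0.
  rewrite pmulr_rle0 // => q_le0.
  by rewrite [q]mulmx_adj_eq0 ?mul0mx //; apply/le_anti; rewrite q_le0 mulmx_adj_ge0.
have le1 : (\rank VF + \rank VG' <= \rank E)%N.
  rewrite -rF -rG' -mxrank_disjoint_sum // mxrankS // addsmx_sub sN' andbT.
  exact: lift_eigenspace_sub spl _.
have le2 : (\rank E <= \rank VF' + \rank VG')%N.
  have sE : (E <= VF' *m (F'^t* *m K) + VG' *m (G'^t* *m K))%MS.
    have EAK : E *m (A *m K) = lam *: E by apply/eigenspaceP.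
    (* lam E = E A K = (E F') F'^* K - (E G') G'^* K. *)
    have sF := restrict_eigenspace_sub spl' hK EAK.
    have sG : (E *m G' <= VG')%MS.
      apply: (restrict_eigenspace_sub splN' hK).
      by rewrite mulNmx mulmxN EAK scaleNr.
    rewrite -(eqmx_scale _ lam0) -EAK; have [-> _] := spl'.
    have -> : (F' *m F'^t* - G' *m G'^t*) *m K
            = F' *m (F'^t* *m K) - G' *m (G'^t* *m K).
      by rewrite mulmxBl !mulmxA.
    rewrite mulmxBr !(mulmxA E); apply: addmx_sub_adds.
      exact: submxMr.
    by rewrite eqmx_opp submxMr.
  apply: leq_trans (mxrankS sE) _; apply: leq_trans (mxrank_adds_leqif _ _) _.
  by apply: leq_add; apply: mxrankM_maxl.
by move: (leq_trans le1 le2); rewrite leq_add2r.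
Qed.

(** * Multiplicities of eigenvalues *)

Lemma count_map_enum (T : Type) n (f : 'I_n -> T) (a : pred T) :
  count a [seq f i | i <- enum 'I_n] = (\sum_i a (f i))%N.
Proof. by rewrite count_map -sum1_count big_enum_cond big_mkcond. Qed.

Lemma perm_filter_count (T : eqType) (a : pred T) (s t : seq T) :
  (forall z, a z -> count_mem z s = count_mem z t) ->
  perm_eq (filter a s) (filter a t).
Proof.
move=> st; apply/allP => z _ /=; rewrite !count_filter.
have [az|/negPf az] := boolP (a z).
  have e (r : seq T) : count (predI (pred1 z) a) r = count_mem z r.
    by apply: eq_count => y /=; case: eqP => // ->.
  by rewrite !e st.
have e (r : seq T) : count (predI (pred1 z) a) r = 0%N.
  by rewrite (@eq_count _ _ pred0) ?count_pred0 // => y /=; case: eqP => // ->.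
by rewrite !e.
Qed.

Lemma rank_diag_mx (F : fieldType) n (d : 'rV[F]_n) :
  \rank (diag_mx d) = (\sum_i (d 0 i != 0)%R)%N.
Proof.
elim: n d => [|n IHn] d.
  by rewrite big_ord0; apply/eqP; rewrite -leqn0 rank_leq_row.
rewrite -[n.+1]/(1 + n)%N in d *; rewrite -[d]hsubmxK diag_mx_row.
rewrite rank_diag_block_mx IHn big_split_ord /= big_ord1; congr (_ + _)%N.
  rewrite rank_rV row_mxEl; congr (nat_of_bool (~~ _)).
  apply/eqP/eqP => [/matrixP/(_ 0 0)|d0]; first by rewrite !mxE eqxx mulr1n.
  by apply/matrixP => i j; rewrite !ord1 mxE d0 mul0rn mxE.
by apply: eq_bigr => i _; rewrite row_mxEr.
Qed.

Lemma rank_eigenspace_diag (F : fieldType) n (d : 'rV[F]_n) (z : F) :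
  \rank (eigenspace (diag_mx d) z) = (\sum_i (d 0 i == z)%R)%N.
Proof.
rewrite mxrank_ker.
have -> : diag_mx d - z%:M = diag_mx (d - const_mx z).
  by rewrite -diag_const_mx linearB.
rewrite rank_diag_mx -[X in (X - _)%N]card_ord -sum1_card.
have -> : (\sum_(i < n) 1 =
    \sum_i (d 0 i == z)%R + \sum_i ((d - const_mx z) 0 i != 0)%R)%N.
  rewrite -big_split; apply: eq_bigr => i _ /=.
  by rewrite !mxE subr_eq0; case: eqP.
by rewrite addnK.
Qed.

Lemma rank_eigenspace_similar (F : fieldType) n (P M : 'M[F]_n) (z : F) :
  P \in unitmx ->
  \rank (eigenspace (invmx P *m M *m P) z) = \rank (eigenspace M z).
Proof.
move=> uP; rewrite !mxrank_ker; congr (_ - _)%N.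
have -> : invmx P *m M *m P - z%:M = invmx P *m (M - z%:M) *m P.
  rewrite mulmxBr mulmxBl; congr (_ - _).
  by rewrite mul_mx_scalar -scalemxAl mulVmx // scalemx1.
rewrite mxrankMfree ?row_free_unit // eqmxMfull //.
by rewrite row_full_unit unitmx_inv.
Qed.

Lemma eigenvalues_diagonalized (R : realType) n (P : 'M[R[i]]_n)
    (d : 'rV[R[i]]_n) :
  P \in unitmx ->
  perm_eq (eigenvalues (invmx P *m diag_mx d *m P))
          [seq d 0 i | i <- enum 'I_n].
Proof.
move=> uP; set M := _ *m P.
have cM : char_poly M = \prod_(i < n) ('X - (d 0 i)%:P).
  have -> : char_poly M = char_poly (diag_mx d).
    rewrite /char_poly; set Q := map_mx polyC P.
    have uQ : Q \in unitmx by rewrite map_unitmx.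
    have -> : char_poly_mx M = invmx Q *m char_poly_mx (diag_mx d) *m Q.
      rewrite /char_poly_mx mulmxBr mulmxBl mul_mx_scalar -scalemxAl.
      by rewrite mulVmx // scalemx1 /M !map_mxM map_invmx.
    by rewrite !det_mulmx mulrAC -det_mulmx mulVmx // det1 mul1r.
  rewrite char_poly_trig ?diag_mx_is_trig //.
  by apply: eq_bigr => i _; rewrite mxE eqxx mulr1n.
rewrite /eigenvalues; case: closed_field_poly_normal => s /= es.
move: es; rewrite (monicP (char_poly_monic _)) scale1r => es.
by apply: prod_XsubC_eq; rewrite -es cM big_map big_enum.
Qed.

(** Algebraic and geometric multiplicities agree for normal matrices: by the
    spectral theorem only the diagonal case has to be checked. *)
Lemma count_eigenvalues (R : realType) n (M : 'M[R[i]]_n) (z : R[i]) :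
  M \is normalmx -> count_mem z (eigenvalues M) = \rank (eigenspace M z).
Proof.
move=> /orthomx_spectralP ->.
have uP := spectral_unit M.
rewrite (permP (eigenvalues_diagonalized _ uP)) rank_eigenspace_similar //.
by rewrite rank_eigenspace_diag count_map_enum.
Qed.

(** * Square roots of real positive semidefinite matrices *)

Section PsdSqrt.
Context {R : realType}.
Local Notation C := (R[i]).

Lemma complexmxM m n p (A : 'M[R]_(m, n)) (B : 'M[R]_(n, p)) :
  map_mx (real_complex R) (A *m B)
  = map_mx (real_complex R) A *m map_mx (real_complex R) B.
Proof. exact: map_mxM. Qed.

Lemma adj_complexmx m n (A : 'M[R]_(m, n)) :
  (map_mx (real_complex R) A)^t* = map_mx (real_complex R) A^T.
Proof. by apply/matrixP => i j; rewrite !mxE; exact: conjc_real. Qed.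

Lemma complexmx_inj m n :
  injective (map_mx (real_complex R) : 'M[R]_(m, n) -> 'M[C]_(m, n)).
Proof. exact: map_mx_inj. Qed.

Lemma complexmx_rect m n (u : 'M[C]_(m, n)) :
  exists a b : 'M[R]_(m, n),
    u = map_mx (real_complex R) a + 'i *: map_mx (real_complex R) b.
Proof.
exists (map_mx (@complex.Re R) u), (map_mx (@complex.Im R) u).
by apply/matrixP => i j; rewrite !mxE; exact: complexE.
Qed.

Lemma mul_row_psd_ge0 m (B : 'M[R]_m) (a : 'rV[R]_m) :
  psdmx B -> 0 <= (a *m B *m a^T) 0 0.
Proof. by move=> [_ /(_ a^T)]; rewrite /dotv trmxK mulmxA. Qed.

(** For u = a + ib the cross terms cancel by symmetry of B and
    u B u^* = a B a^T + b B b^T. *)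
Lemma complexmx_psd m (B : 'M[R]_m) (u : 'rV[C]_m) :
  psdmx B -> 0 <= (u *m complexmx B *m u^t*) 0 0.
Proof.
move=> psdB; have [BT _] := psdB; have [a [b ->]] := complexmx_rect u.
have cross : b *m B *m a^T = a *m B *m b^T.
  have -> : b *m B *m a^T = (b *m B *m a^T)^T.
    by apply/matrixP => i j; rewrite !ord1 [RHS]mxE.
  by rewrite !trmx_mul trmxK BT mulmxA.
have -> : (map_mx (real_complex R) a + 'i *: map_mx (real_complex R) b)^t*
   = map_mx (real_complex R) a^T - 'i *: map_mx (real_complex R) b^T.
  rewrite linearD /= map_mxD linearZ /= map_mxZ !adj_complexmx.
  rewrite [X in X *: _](_ : _ = - 'i); last first.
    by apply/eqP; rewrite eq_complex /= oppr0 !eqxx.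
  by rewrite scaleNr.
rewrite /complexmx !mulmxDl mulmxDr mulmxDr !mulmxN -!scalemxAl -!scalemxAr.
rewrite -!complexmxM cross scalerA -expr2 sqr_i scaleN1r opprK.
rewrite addrA subrK -map_mxD mxE [_ 0 0]mxE lecR addr_ge0 //.
  exact: mul_row_psd_ge0.
exact: mul_row_psd_ge0.
Qed.

Lemma hermitian_complexmx m (B : 'M[R]_m) : B^T = B -> complexmx B \is hermsymmx.
Proof.
by move=> BT; apply/is_hermitianmxP; rewrite scale1r adj_complexmx BT.
Qed.

(** The complex spectral theorem gives a square root S = P^* sqrt(D) P.  It is
    real: its conjugate Q^* sqrt(D) Q, with Q the conjugate of P, comes from
    another diagonalization of the real matrix B, the change of basis Q P^*
    commutes with D, hence with sqrt(D), and so both square roots coincide. *)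
Lemma psdmx_sqrt_exists m (B : 'M[R]_m) :
  psdmx B -> exists S : 'M[R]_m, psdmx S /\ S *m S = B.
Proof.
move=> psdB; have [BT _] := psdB.
have /hermitian_normalmx/orthomx_spectralP := hermitian_complexmx BT.
set P := spectralmx _; set d := spectral_diag _ => eB.
have uP : P \is unitarymx by apply: spectral_unitarymx.
have PP : P *m P^t* = 1%:M by apply/unitarymxP.
have PP' : P^t* *m P = 1%:M by apply: mulmx1C.
move: eB; rewrite invmx_unitary // => eB.
have ed : P *m complexmx B *m P^t* = diag_mx d.
  by rewrite eB !mulmxA PP mul1mx -mulmxA PP mulmx1.
have d_ge0 i : 0 <= d 0 i.
  have := complexmx_psd (row i P) psdB.
  rewrite rowE adjmxM trmx_delta map_delta_mx.
  have -> (e : 'rV_m) (f : 'cV_m) : e *m P *m complexmx B *m (P^t* *m f)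
      = e *m (P *m complexmx B *m P^t*) *m f by rewrite !mulmxA.
  by rewrite ed -rowE -colE !mxE eqxx mulr1n.
pose r := \row_i sqrtC (d 0 i).
have r_ge0 i : 0 <= r 0 i by rewrite mxE sqrtC_ge0.
have r_real : map_mx Num.conj r = r.
  by apply/rowP => i; rewrite [LHS]mxE; apply: conj_Creal; rewrite realE r_ge0.
pose S := P^t* *m diag_mx r *m P.
have SS : S *m S = complexmx B.
  rewrite /S eB !mulmxA -[_ *m P *m P^t*]mulmxA PP mulmx1.
  rewrite -[_ *m diag_mx r *m diag_mx r]mulmxA mulmx_diag.
  congr (_ *m diag_mx _ *m _).
  by apply/rowP => i; rewrite !mxE -expr2 sqrtCK.
have S_adj : S^t* = S.
  by rewrite !adjmxM trmxCK tr_diag_mx map_diag_mx r_real mulmxA.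
have S_conj : map_mx Num.conj S = S.
  pose Q := map_mx Num.conj P.
  have d_real : map_mx Num.conj d = d.
    by apply/rowP => i; rewrite [LHS]mxE; apply: conj_Creal; rewrite realE d_ge0.
  have QQ : Q^t* *m Q = 1%:M.
    by rewrite /Q map_trmx -map_mxM PP' map_mx1.
  have QB : Q *m complexmx B = diag_mx d *m Q.
    have := congr1 (fun X : 'M_m => map_mx Num.conj (X *m P)) ed.
    rewrite /= -mulmxA PP' mulmx1 !map_mxM map_diag_mx d_real => <-.
    congr (_ *m _); apply/matrixP => i j; rewrite !mxE; apply/esym/conjc_real.
  pose W := Q *m P^t*.
  have Wd : W *m diag_mx d = diag_mx d *m W.
    rewrite /W [RHS]mulmxA -QB -ed !mulmxA -[_ *m P^t* *m P]mulmxA PP'.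
    by rewrite mulmx1.
  (* Entrywise, W i j is zero unless the diagonal entries i and j agree. *)
  have Wr : W *m diag_mx r = diag_mx r *m W.
    apply/matrixP => i j; move/matrixP/(_ i j): Wd.
    rewrite !mul_mx_diag !mul_diag_mx !mxE => /eqP.
    rewrite mulrC -subr_eq0 -mulrBl mulf_eq0 subr_eq0 => /orP[/eqP->|/eqP->].
      by rewrite mulrC.
    by rewrite mulr0 mul0r.
  have -> : map_mx Num.conj S = Q^t* *m diag_mx r *m Q.
    by rewrite /S !map_mxM map_diag_mx r_real /Q map_trmx.
  have eQ : Q = W *m P by rewrite -mulmxA PP' mulmx1.
  by rewrite {2}eQ mulmxA -[_ *m W]mulmxA -Wr /W !mulmxA QQ mul1mx.
exists (map_mx (@complex.Re R) S).
have eS : map_mx (real_complex R) (map_mx (@complex.Re R) S) = S.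
  apply/matrixP => i j; rewrite [LHS]mxE [X in X%:C]mxE; apply: RRe_real.
  by apply/CrealP; move/matrixP/(_ i j): S_conj; rewrite mxE.
split; last by apply: complexmx_inj; rewrite complexmxM eS.
split.
  by apply: complexmx_inj; rewrite -adj_complexmx eS.
move=> x; rewrite -lecR /dotv mulmxA.
have -> : ((x^T *m map_mx (@complex.Re R) S *m x) 0 0)%:C =
    (map_mx (real_complex R) (x^T *m map_mx (@complex.Re R) S *m x)) 0 0.
  by rewrite [RHS]mxE.
rewrite !complexmxM eS /S -adj_complexmx; set y := map_mx _ x.
rewrite -!mulmxA !mulmxA -[_ *m P *m y]mulmxA.
have -> : y^t* *m P^t* = (P *m y)^t* by rewrite adjmxM.
set z := P *m y; rewrite mul_mx_diag mxE sumr_ge0 // => k _.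
by rewrite !mxE mulrAC mulr_ge0 // -?normCKC ?exprn_ge0 // sqrtC_ge0.
Qed.

Lemma psdsqrtP m (B : 'M[R]_m) :
  psdmx B -> psdmx (psdsqrt B) /\ psdsqrt B *m psdsqrt B = B.
Proof.
move=> /psdmx_sqrt_exists ?.
exact: (@xgetPex _ 0 [set S | psdmx S /\ S *m S = B]%classic).
Qed.

End PsdSqrt.

(** * Symplectic projections *)

Lemma eq_mulmx_cV (F : pzRingType) m n (A B : 'M[F]_(m, n)) :
  (forall x : 'cV_n, A *m x = B *m x) -> A = B.
Proof.
move=> eqAB; apply/matrixP => i j; have := eqAB (delta_mx j 0).
by rewrite -!colE => /colP/(_ i); rewrite !mxE.
Qed.

Lemma dotvDl (R : realType) m (x y z : 'cV[R]_m) :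
  dotv (x + y) z = dotv x z + dotv y z.
Proof. by rewrite /dotv linearD mulmxDl mxE. Qed.

Lemma dotvDr (R : realType) m (x y z : 'cV[R]_m) :
  dotv x (y + z) = dotv x y + dotv x z.
Proof. by rewrite /dotv mulmxDr mxE. Qed.

Lemma dotvC (R : realType) m (x y : 'cV[R]_m) : dotv x y = dotv y x.
Proof. by rewrite /dotv -[y in LHS]trmxK -trmx_mul mxE. Qed.

Lemma dotv_trmx (R : realType) m p (A : 'M[R]_(m, p)) x y :
  dotv x (A *m y) = dotv (A^T *m x) y.
Proof. by rewrite /dotv trmx_mul trmxK mulmxA. Qed.

Lemma eq_dotv (R : realType) m (A B : 'M[R]_m) :
  (forall x y, dotv x (A *m y) = dotv x (B *m y)) -> A = B.
Proof.
move=> eqAB; apply/matrixP => i j.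
have := eqAB (delta_mx i 0) (delta_mx j 0).
by rewrite /dotv trmx_delta -!colE -!rowE !mxE.
Qed.

Section SymplecticProjections.
Context {R : realType} {n : nat}.
Implicit Types (P : 'M[R]_(n + n)) (W : {vspace 'cV[R]_(n + n)}).
Local Notation J := (@sympJ R n).

Lemma trmx_sympJ : J^T = - J.
Proof.
by rewrite /sympJ tr_block_mx opp_block_mx !trmx0 linearN /= trmx1 opprK !oppr0.
Qed.

Lemma mulmx_sympJ : J *m J = - 1%:M.
Proof.
rewrite /sympJ mulmx_block !mulmx0 !mul0mx !addr0 !add0r mul1mx mulmx1.
by rewrite (scalar_mx_block n n) opp_block_mx !oppr0.
Qed.

Lemma mulmx_sympJ_inj p :
  injective (mulmx J : 'M[R]_(n + n, p) -> 'M_(n + n, p)).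
Proof.
apply: (can_inj (g := mulmx (- J))) => X.
by rewrite mulmxA mulNmx mulmx_sympJ opprK mul1mx.
Qed.

(** The symplectic complement is the kernel of a map into a space of dimension
    dim W, so its dimension is at least 2n - dim W; as it meets W trivially, the
    sum of the two is the whole space. *)
Lemma symplectic_subspace_split W : symplectic_subspace W ->
  forall x, exists w u, [/\ w \in W, sympl_compl [set` W]%classic u & x = w + u].
Proof.
move=> Wsymp x; pose b := vbasis W.
pose M : 'M[R]_(\dim W, n + n) := \matrix_i (J *m b`_i)^T.
pose U := lker (linfun (mulmx M : 'cV_(n + n) -> 'cV_(\dim W))).
have compl_U u : u \in U -> sympl_compl [set` W]%classic u.
  rewrite memv_ker lfunE /= => /eqP Mu v vW.
  rewrite (coord_vbasis vW) mulmx_sumr /dotv mulmx_sumr summxE big1 // => i _.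
  rewrite -scalemxAr -scalemxAr mxE.
  have /colP/(_ i) := Mu; rewrite [RHS]mxE => Mui.
  have -> : (u^T *m (J *m b`_i)) 0 0 = (M *m u) i 0.
    rewrite -[LHS]/(dotv u _) dotvC /dotv [LHS]mxE [RHS]mxE.
    by apply: eq_bigr => j _; rewrite [M i j]mxE.
  by rewrite Mui mulr0.
have : x \in (W + U)%VS.
  suff -> : (W + U)%VS = fullv by rewrite memvf.
  apply/eqP; rewrite -dimv_leqif_eq ?subvf // eqn_leq dimvS ?subvf //=.
  rewrite dimv_disjoint_sum.
    have := limg_ker_dim (linfun (mulmx M : 'cV_(n + n) -> 'cV_(\dim W))) fullv.
    rewrite capfv => <-; rewrite addnC leq_add2r.
    have := dimvS (subvf (limg (linfun (mulmx M : 'cV_(n + n) -> 'cV_(\dim W))))).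
    by rewrite dimvf dim_matrix mulr1.
  apply/eqP; rewrite -subv0; apply/subvP => v; rewrite memv_cap => /andP[vW /compl_U vU].
  have : ([set` W] `&` sympl_compl [set` W])%classic v by [].
  by rewrite Wsymp => ->; rewrite mem0v.
by move=> /memv_addP[w wW [u uU ->]]; exists w, u; split => //; apply: compl_U.
Qed.

Lemma sympl_projection_idem P : sympl_projection P -> P *m P = P.
Proof.
move=> [W [Wsymp fixW killW]]; apply: eq_mulmx_cV => x.
rewrite -mulmxA.
have [w [u [wW uU ->]]] := symplectic_subspace_split Wsymp x.
by rewrite !(mulmxDr, fixW _ wW, killW _ uU, mulmx0, addr0).
Qed.

(** P is self-adjoint for the symplectic form: decomposing x and y along W and
    its complement, both sides pair the components in W. *)
Lemma sympl_projection_trmx P : sympl_projection P -> P^T *m J = J *m P.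
Proof.
move=> [W [Wsymp fixW killW]]; apply: eq_dotv => x y.
rewrite -mulmxA dotv_trmx trmxK -mulmxA.
have [w [u [wW uU ->]]] := symplectic_subspace_split Wsymp x.
have [v [t [vW tU ->]]] := symplectic_subspace_split Wsymp y.
rewrite !mulmxDr !(fixW _ wW, fixW _ vW, killW _ uU, killW _ tU, mulmx0, addr0).
rewrite dotvDr dotvDl (uU _ vW) addr0 [X in _ + X]dotv_trmx trmx_sympJ.
rewrite mulNmx [X in _ + X]dotvC.
rewrite [X in _ + X](_ : _ = 0) ?addr0 // /dotv mulmxN mxE -/(dotv t _).
by rewrite (tU _ wW) oppr0.
Qed.

Lemma sympl_projection_comm P :
  sympl_projection P -> P *m J = J *m P^T.
Proof.
move=> /sympl_projection_trmx PJ; apply: mulmx_sympJ_inj.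
by rewrite !mulmxA -PJ -mulmxA mulmx_sympJ mulmxN mulNmx mulmx1 mul1mx.
Qed.

(** Taking adjoints for the symplectic form exchanges P Q and Q P. *)
Lemma sympl_projection_mul_eq0 P Q :
  sympl_projection P -> sympl_projection Q -> P *m Q = 0 -> Q *m P = 0.
Proof.
move=> /sympl_projection_trmx PJ /sympl_projection_trmx QJ PQ.
apply: mulmx_sympJ_inj.
by rewrite mulmxA -QJ -mulmxA -PJ mulmxA -trmx_mul PQ trmx0 mul0mx mulmx0.
Qed.

End SymplecticProjections.

(** * Diagonalization of iJ along a symplectic basis *)

Section NormalForm.
Context {R : realType} {n : nat}.
Local Notation C := (R[i]).
Local Notation J := (@sympJ R n).

Definition iJ : 'M[C]_(n + n) := 'i *: complexmx J.

Lemma conj_i : Num.conj ('i : C) = - 'i.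
Proof. by apply/eqP; rewrite eq_complex /= oppr0 !eqxx. Qed.

Lemma iJ_block : iJ = block_mx 0 'i%:M (- 'i)%:M 0.
Proof.
rewrite /iJ /complexmx /sympJ map_block_mx scale_block_mx !map_mx0 !scaler0.
by rewrite map_mxN map_mx1 scalerN -scaleNr !scalemx1.
Qed.

Lemma adj_iJ : iJ^t* = iJ.
Proof.
rewrite iJ_block tr_block_mx map_block_mx !trmx0 !map_mx0 !tr_scalar_mx.
by rewrite !map_scalar_mx /= rmorphN /= !conj_i opprK.
Qed.

(** The columns are orthogonal eigenvectors of iJ, of squared norm 2: the first
    n for the eigenvalue -1 and the last n for the eigenvalue 1.  The blocks are
    scalar, so that diagonal blocks commute with them. *)
Definition iJ_frame : 'M[C]_(n + n) := block_mx 1%:M 1%:M 'i%:M (- 'i)%:M.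

Lemma adj_iJ_frame : iJ_frame^t* = block_mx 1%:M (- 'i)%:M 1%:M 'i%:M.
Proof.
rewrite tr_block_mx map_block_mx !tr_scalar_mx !map_scalar_mx /=.
by rewrite rmorphN rmorph1 /= conj_i opprK.
Qed.

Lemma iJ_frame_diag :
  iJ_frame^t* *m iJ *m iJ_frame = block_mx (- 2)%:M 0 0 2%:M.
Proof.
have ii : 'i * 'i = -1 :> C by rewrite -expr2 sqr_i.
rewrite adj_iJ_frame iJ_block !mulmx_block.
rewrite !mulmx0 !mul1mx !mulmx1 !addr0 !add0r -!scalar_mxM !mulrN !mulNr ii !opprK.
rewrite -!raddfD /= ?opprK; congr block_mx.
- by rewrite rmorphD.
- by rewrite addNr raddf0.
- by rewrite addrN raddf0.
- by rewrite rmorphD.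
Qed.

Lemma iJ_frame_mul (e : 'rV[C]_n) :
  iJ_frame *m diag_mx (row_mx e e) *m iJ_frame^t*
  = diag_mx (row_mx (2 *: e) (2 *: e)).
Proof.
have ii : 'i * 'i = -1 :> C by rewrite -expr2 sqr_i.
rewrite adj_iJ_frame !diag_mx_row !mulmx_block.
rewrite !mulmx0 !mul1mx !mulmx1 !addr0 !add0r !mul_scalar_mx !mul_mx_scalar.
rewrite !scalerA !mulrN !mulNr ii.
rewrite opprK scale1r !scaleNr addNr addrN linearZ /=.
by rewrite scaler_nat mulr2n.
Qed.

Lemma symplecticmx_unit (M : 'M[R]_(n + n)) : symplecticmx M -> M \in unitmx.
Proof.
move=> MJM; have : (- J *m M^T *m J) *m M = 1%:M.
  by rewrite -!mulmxA [M^T *m _]mulmxA MJM mulNmx mulmx_sympJ opprK.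
by case/mulmx1_unit.
Qed.

(** The set of symplectic matrices is stable under inverse and transpose. *)
Lemma symplecticmx_inv_adj (M : 'M[R]_(n + n)) : symplecticmx M ->
  invmx M *m J *m (invmx M)^T = J.
Proof.
move=> MJM; have uM := symplecticmx_unit MJM.
have MJ : J *m M^T *m J = - invmx M.
  rewrite -[LHS]mulmx1 -(mulmxV uM) mulmxA -!(mulmxA J) MJM mulmxA mulmx_sympJ.
  by rewrite mulNmx mul1mx.
have -> : (invmx M)^T = - (J *m M *m J).
  rewrite -[invmx M]opprK -MJ linearN /= !trmx_mul trmxK trmx_sympJ.
  by rewrite !(mulNmx, mulmxN) opprK mulmxA.
rewrite mulmxN !mulmxA -[_ *m J *m J]mulmxA mulmx_sympJ mulmxN mulmx1.
by rewrite mulNmx mulVmx // mulNmx opprK mul1mx.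
Qed.

(** If M^T A M = D + D with D >= 0 and e is such that 2 e_j^2 = d_j, then this
    factor F satisfies F F^* = A. *)
Definition williamson_factor (M : 'M[R]_(n + n)) (e : 'rV[R]_n) : 'M[C]_(n + n) :=
  let f := map_mx (real_complex R) e in
  complexmx (invmx M)^T *m iJ_frame *m diag_mx (row_mx f f).

Lemma williamson_factor_sqr M (e : 'rV[R]_n) :
  williamson_factor M e *m (williamson_factor M e)^t*
  = complexmx ((invmx M)^T *m
      diag_mx (row_mx (\row_i (2 * e 0 i ^+ 2)) (\row_i (2 * e 0 i ^+ 2)))
      *m invmx M).
Proof.
rewrite /williamson_factor; set f := map_mx _ e.
rewrite !adjmxM tr_diag_mx map_diag_mx map_row_mx.
have -> : map_mx Num.conj f = f.
  by apply/rowP => i; rewrite [LHS]mxE [f 0 i]mxE; apply: conjc_real.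
rewrite adj_complexmx trmxK !mulmxA -[_ *m diag_mx _ *m diag_mx _]mulmxA.
rewrite mulmx_diag.
have -> : \row_i (row_mx f f 0 i * row_mx f f 0 i)
    = row_mx (\row_i (f 0 i ^+ 2)) (\row_i (f 0 i ^+ 2)).
  apply/rowP => i; rewrite [LHS]mxE; case: (split_ordP i) => j ->.
    by rewrite !row_mxEl [RHS]mxE expr2.
  by rewrite !row_mxEr [RHS]mxE expr2.
have -> (N X N' : 'M[C]_(n + n)) : N *m iJ_frame *m X *m iJ_frame^t* *m N'
    = N *m (iJ_frame *m X *m iJ_frame^t*) *m N' by rewrite !mulmxA.
rewrite iJ_frame_mul.
rewrite /complexmx !complexmxM map_diag_mx map_row_mx.
by congr (_ *m diag_mx (row_mx _ _) *m _);
  apply/rowP => i; rewrite !mxE rmorphM rmorphXn rmorph_nat.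
Qed.

(** The inverse transpose of M preserves J as M does, so the form reduces to the
    diagonal one of [iJ_frame]. *)
Lemma williamson_factor_form M (e h : 'rV[R]_n) : symplecticmx M ->
  (williamson_factor M e)^t* *m iJ *m williamson_factor M h =
  diag_mx (row_mx (\row_i (- 2 * e 0 i * h 0 i)%:C)
                  (\row_i (2 * e 0 i * h 0 i)%:C)).
Proof.
move=> MJM; have hJ : (complexmx (invmx M)^T)^t* *m iJ *m complexmx (invmx M)^T = iJ.
  rewrite adj_complexmx trmxK /iJ -scalemxAr -scalemxAl -!complexmxM.
  by rewrite symplecticmx_inv_adj.
rewrite /williamson_factor; set N := complexmx _ in hJ *.
set f := map_mx _ e; set g := map_mx _ h.
rewrite !adjmxM tr_diag_mx map_diag_mx map_row_mx.
have -> : map_mx Num.conj f = f.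
  by apply/rowP => i; rewrite [LHS]mxE [f 0 i]mxE; apply: conjc_real.
have -> (X Y : 'M[C]_(n + n)) : X *m (iJ_frame^t* *m N^t*) *m iJ *m (N *m iJ_frame *m Y)
   = X *m (iJ_frame^t* *m (N^t* *m iJ *m N) *m iJ_frame) *m Y by rewrite !mulmxA.
rewrite hJ iJ_frame_diag !diag_mx_row !mulmx_block.
rewrite !mulmx0 !mul0mx !addr0 !add0r !mul0mx ?addr0 ?add0r.
rewrite !mul_mx_scalar -!scalemxAl !mulmx_diag -!linearZ /=.
by congr (block_mx (diag_mx _) _ _ (diag_mx _)); apply/rowP => i;
  rewrite !mxE !rmorphM ?rmorphN rmorph_nat mulrA.
Qed.

End NormalForm.

(** * Two splittings of A *)

(** A real symmetric matrix and its square have the same kernel: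
    |S z|^2 = <z, S S z>. *)
Lemma sym_mulmx_eq0 (R : realType) m p (S : 'M[R]_m) (Y : 'M[R]_(m, p)) :
  S^T = S -> S *m S *m Y = 0 -> S *m Y = 0.
Proof.
move=> ST SSY; apply: eq_mulmx_cV => x; rewrite mul0mx -mulmxA.
set z := S *m _.
have : dotv z z = 0.
  by rewrite {2}/z dotv_trmx ST /z !mulmxA SSY mul0mx /dotv trmx0 mul0mx mxE.
rewrite /dotv mxE => /eqP; rewrite psumr_eq0 => [/allP z0|i _]; last first.
  by rewrite mxE -expr2 sqr_ge0.
apply/colP => i; have := z0 i; rewrite mem_index_enum !mxE => /(_ isT).
by rewrite -expr2 sqrf_eq0 => /eqP.
Qed.

Section Compression.
Context {R : realType} {m : nat}.
Implicit Types A P : 'M[R]_m.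

(** Since P is idempotent, the form at x has the same value as at P x, which lies
    in the range where the form is definite. *)
Lemma dotv_compression_ge0 A P : P *m P = P ->
  posdef_on (P^T *m A *m P) (mxrange P) ->
  forall x, 0 <= dotv x (P^T *m A *m P *m x) ?= iff (P *m x == 0).
Proof.
move=> PP pos x.
have eB : P^T *m A *m P = P^T *m (P^T *m A *m P *m P).
  by rewrite -[_ *m P *m P]mulmxA PP !mulmxA -trmx_mul PP.
have e : dotv x (P^T *m A *m P *m x)
    = dotv (P *m x) (P^T *m A *m P *m (P *m x)).
  by rewrite {1}eB -mulmxA dotv_trmx trmxK mulmxA.
rewrite e; apply/leifP; have [->|Px0] := eqVneq (P *m x) 0.
  by rewrite mulmx0 /dotv mulmx0 mxE.
by apply: pos => //; exists x.
Qed.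

Lemma psdmx_compression A P : A^T = A -> P *m P = P ->
  posdef_on (P^T *m A *m P) (mxrange P) -> psdmx (P^T *m A *m P).
Proof.
move=> AT PP pos; split; first by rewrite !trmx_mul trmxK AT mulmxA.
by move=> x; case: (dotv_compression_ge0 PP pos x).
Qed.

End Compression.

Section Main.
Context {R : realType} {n : nat}.
Local Notation J := (@sympJ R n).
Local Notation C := (R[i]).

Lemma iSJSE (B : 'M[R]_(n + n)) : psdmx B ->
  iSJS B = (complexmx (psdsqrt B))^t* *m iJ *m complexmx (psdsqrt B).
Proof.
move=> /psdsqrtP[[ST _] _].
by rewrite adj_complexmx ST /iSJS /iJ -scalemxAr -scalemxAl -!complexmxM.
Qed.

Lemma iSJS_normal (B : 'M[R]_(n + n)) : psdmx B -> iSJS B \is normalmx.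
Proof.
move=> psdB; apply/hermitian_normalmx/is_hermitianmxP.
by rewrite scale1r iSJSE // !adjmxM trmxCK adj_iJ mulmxA.
Qed.

(** From B J B' = 0 the two square factors B and B' can be replaced by their
    square roots, one at a time, by [sym_mulmx_eq0]. *)
Lemma sqrt_splitting (A B B' : 'M[R]_(n + n)) : psdmx B -> psdmx B' ->
  A = B - B' -> B *m J *m B' = 0 ->
  signed_splitting (complexmx A) iJ (complexmx (psdsqrt B)) (complexmx (psdsqrt B')).
Proof.
move=> psdB psdB' -> BJB'; have [[BT _] [BT' _]] := (psdB, psdB').
have [[ST _] SS] := psdsqrtP psdB; have [[ST' _] SS'] := psdsqrtP psdB'.
rewrite /signed_splitting !adj_complexmx ST ST' -!complexmxM SS SS'.
split; first by rewrite /complexmx map_mxB.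
rewrite /iJ -scalemxAr -scalemxAl -!complexmxM.
suff -> : psdsqrt B *m J *m psdsqrt B' = 0 by rewrite map_mx0 scaler0.
have S'JB : psdsqrt B' *m (J^T *m B) = 0.
  apply: sym_mulmx_eq0 => //; rewrite SS' mulmxA.
  by rewrite -[B' in LHS]BT' -[B in LHS]BT -trmx_mul -trmx_mul mulmxA BJB' trmx0.
rewrite -mulmxA; apply: sym_mulmx_eq0 => //; rewrite SS.
by apply/trmx_inj; rewrite !trmx_mul ST' BT trmx0 -mulmxA S'JB.
Qed.

Lemma count_eigenvalues_iSJS (A B B' : 'M[R]_(n + n)) k l
    (F : 'M[C]_(n + n, k)) (G : 'M[C]_(n + n, l)) (z : C) :
  z != 0 -> psdmx B -> psdmx B' -> A = B - B' -> B *m J *m B' = 0 ->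
  signed_splitting (complexmx A) iJ F G ->
  count_mem z (eigenvalues (iSJS B)) = \rank (eigenspace (F^t* *m iJ *m F) z).
Proof.
move=> z0 psdB psdB' eA BJB' spl; have splB := sqrt_splitting psdB psdB' eA BJB'.
rewrite count_eigenvalues ?iSJS_normal // iSJSE //.
by apply/eqP; rewrite eqn_leq (rank_eigenspace_le adj_iJ z0 splB spl)
  (rank_eigenspace_le adj_iJ z0 spl splB).
Qed.

(** The factor 1/2 compensates for the squared norm 2 of the columns of
    [iJ_frame]; entries with c_j < 0 are replaced by 0, so that c and - c give the
    positive and negative parts of c. *)
Definition half_sqrt (c : 'rV[R]_n) : 'rV[R]_n :=
  \row_j Num.sqrt (Num.max (c 0 j) 0 / 2).

Lemma half_sqrtE c j : 2 * half_sqrt c 0 j ^+ 2 = Num.max (c 0 j) 0.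
Proof.
rewrite mxE sqr_sqrtr ?divr_ge0 ?le_max ?lexx ?orbT //.
by rewrite mulrC divfK ?pnatr_eq0.
Qed.

Section Williamson.
Variables (A M : 'M[R]_(n + n)) (d : 'rV[R]_n).
Hypotheses (MJM : symplecticmx M)
  (MAM : M^T *m A *m M = block_mx (diag_mx d) 0 0 (diag_mx d)).

(** d is split into its positive and negative parts, whose product vanishes
    entry by entry. *)
Lemma williamson_splitting :
  signed_splitting (complexmx A) iJ (williamson_factor M (half_sqrt d))
    (williamson_factor M (half_sqrt (- d))).
Proof.
have uM := symplecticmx_unit MJM.
split.
  rewrite !williamson_factor_sqr -map_mxB; congr map_mx.
  rewrite -mulmxBl -mulmxBr -linearB /= opp_row_mx add_row_mx.
  have -> : \row_i (2 * half_sqrt d 0 i ^+ 2)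
      - \row_i (2 * half_sqrt (- d) 0 i ^+ 2) = d.
    apply/rowP => j; rewrite [LHS]mxE [X in X + _]mxE [X in _ + X]mxE.
    rewrite [X in - X]mxE !half_sqrtE (_ : (- d) 0 j = - d 0 j); last by rewrite mxE.
    have [h|/ltW h] := leP 0 (d 0 j).
      by rewrite max_r ?oppr_le0 // subr0.
    by rewrite max_l ?oppr_ge0 // sub0r opprK.
  rewrite diag_mx_row -MAM !mulmxA -trmx_mul mulmxV // trmx1 mul1mx.
  by rewrite -mulmxA mulmxV // mulmx1.
rewrite williamson_factor_form // -[RHS]/(0 : 'M_(n + n)).
rewrite -(linear0 (@diag_mx C _)) -(row_mx0 C 1 n n).
suff e0 j : half_sqrt d 0 j * half_sqrt (- d) 0 j = 0.
  congr (diag_mx (row_mx _ _)); apply/rowP => j;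
  by rewrite [LHS]mxE [RHS]mxE -mulrA e0 mulr0.
rewrite !mxE; have [d_ge0|/ltW d_le0] := leP 0 (d 0 j).
  by rewrite [Num.max (- _) _]max_r ?oppr_le0 // mul0r sqrtr0 mulr0.
by rewrite mul0r sqrtr0 mul0r.
Qed.

(** F^* K F is diagonal with entries - max(c_j, 0) and max(c_j, 0); only the
    second half can contribute a positive eigenvalue. *)
Lemma rank_williamson_pos c (z : C) : 0 < z ->
  let F := williamson_factor M (half_sqrt c) in
  \rank (eigenspace (F^t* *m iJ *m F) z) = (\sum_j ((c 0 j)%:C == z)%R)%N.
Proof.
move=> z_gt0 F; rewrite williamson_factor_form // rank_eigenspace_diag.
rewrite big_split_ord /= [X in (X + _)%N]big1 => [|j _].
  apply: eq_bigr => j _; rewrite row_mxEr mxE -mulrA -expr2 half_sqrtE.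
  case: lerP => // c_le0; congr nat_of_bool.
  transitivity false; first by apply: contraTF z_gt0 => /eqP <-; rewrite ltcR ltxx.
  by apply/esym; apply: contraTF z_gt0 => /eqP <-; rewrite ltcR -leNgt.
rewrite row_mxEl mxE -mulrA -expr2 mulNr half_sqrtE.
case: eqP => // ez; move: z_gt0; rewrite -ez ltcR oppr_gt0.
by rewrite ltNge le_max lexx orbT.
Qed.

Lemma rank_williamson_neg c (z : C) : z < 0 ->
  let F := williamson_factor M (half_sqrt c) in
  \rank (eigenspace (F^t* *m iJ *m F) z) = (\sum_j ((- c 0 j)%:C == z)%R)%N.
Proof.
move=> z_lt0 F; rewrite williamson_factor_form // rank_eigenspace_diag.
rewrite big_split_ord /= [X in (_ + X)%N]big1 ?addn0 => [|j _].
  apply: eq_bigr => j _; rewrite row_mxEl mxE -mulrA -expr2 mulNr half_sqrtE.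
  case: lerP => // c_le0; congr nat_of_bool.
  transitivity false; first by apply: contraTF z_lt0 => /eqP <-; rewrite oppr0 ltcR ltxx.
  by apply/esym; apply: contraTF z_lt0 => /eqP <-; rewrite ltcR -leNgt oppr_ge0.
rewrite row_mxEr mxE -mulrA -expr2 half_sqrtE.
case: eqP => // ez; move: z_lt0; rewrite -ez ltcR.
by rewrite ltNge le_max lexx orbT.
Qed.

Lemma rank_williamson : \rank A = (\sum_j (d 0 j != 0)%R).*2.
Proof.
have uM := symplecticmx_unit MJM.
have -> : \rank A = \rank (M^T *m A *m M).
  rewrite mxrankMfree ?row_free_unit // eqmxMfull // row_full_unit.
  by rewrite unitmx_tr.
by rewrite MAM rank_diag_block_mx !rank_diag_mx addnn.
Qed.

End Williamson.

Lemma count_eigenvalues_iSJS_pos (A B B' : 'M[R]_(n + n)) d :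
  psdmx B -> psdmx B' -> A = B - B' -> B *m J *m B' = 0 ->
  symplectic_eigenvalues A d ->
  forall z : C, 0 < z ->
  count_mem z (eigenvalues (iSJS B)) = (\sum_j ((d 0 j)%:C == z)%R)%N.
Proof.
move=> psdB psdB' eA BJB' [M [MJM MAM]] z z_gt0.
rewrite (count_eigenvalues_iSJS (lt0r_neq0 z_gt0) psdB psdB' eA BJB'
  (williamson_splitting MJM MAM)).
exact: rank_williamson_pos.
Qed.

(** Here B' is the positive part of - A, so that the entries of - d occur.  The
    negative eigenvalues of the form are the numbers - max(- d_j, 0) = d_j with
    d_j < 0. *)
Lemma count_eigenvalues_iSJS_neg (A B B' : 'M[R]_(n + n)) d :
  psdmx B -> psdmx B' -> A = B - B' -> B *m J *m B' = 0 ->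
  symplectic_eigenvalues A d ->
  forall z : C, z < 0 ->
  count_mem z (eigenvalues (iSJS B')) = (\sum_j ((d 0 j)%:C == z)%R)%N.
Proof.
move=> psdB psdB' eA BJB' [M [MJM MAM]] z z_lt0.
have [psdB1 psdB1'] := (psdB.1, psdB'.1).
have BJB'T : B' *m J *m B = 0.
  apply/oppr_inj; rewrite oppr0 -mulNmx -mulmxN -trmx_sympJ -psdB1 -psdB1'.
  by rewrite -trmx_mul -trmx_mul mulmxA BJB' trmx0.
have eA' : - A = B' - B by rewrite eA opprB.
have spl := signed_splittingN adj_iJ (williamson_splitting MJM MAM).
have eNA : - complexmx A = complexmx (- A) by rewrite /complexmx map_mxN.
rewrite eNA in spl.
rewrite (count_eigenvalues_iSJS (ltr0_neq0 z_lt0) psdB' psdB eA' BJB'T spl).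
rewrite rank_williamson_neg //.
by apply: eq_bigr => j _; rewrite mxE opprK.
Qed.

End Main.

(** * Symplectic eigenvalues *)

(** The kernel of A is the range of P0.  If A x = 0, pairing A x with Pp x only
    leaves the form of Pp^T A Pp at Pp x, so Pp x = 0 by definiteness; likewise
    Pm x = 0, and x = P0 x. *)
Lemma rank_sympl_projection_ker (R : realType) n (A Pm P0 Pp : 'M[R]_(n + n)) :
  Pm *m Pm = Pm -> Pp *m Pp = Pp ->
  [/\ Pm *m P0 = 0, Pp *m P0 = 0, Pm *m Pp = 0 & Pp *m Pm = 0] ->
  Pm + P0 + Pp = 1%:M -> A = Pm^T *m A *m Pm + Pp^T *m A *m Pp ->
  negdef_on (Pm^T *m A *m Pm) (mxrange Pm) ->
  posdef_on (Pp^T *m A *m Pp) (mxrange Pp) ->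
  (\rank A + \rank P0 = n + n)%N.
Proof.
move=> PmPm PpPp [PmP0 PpP0 PmPp PpPm] sumP eA neg pos.
have AP0 : A *m P0 = 0.
  by rewrite eA mulmxDl -!mulmxA PmP0 PpP0 !mulmx0 addr0.
have kerP (x : 'cV_(n + n)) : A *m x = 0 -> P0 *m x = x.
  move=> Ax.
  have dec y : dotv y (Pm^T *m A *m Pm *m x) + dotv y (Pp^T *m A *m Pp *m x) = 0.
    by rewrite -dotvDr -mulmxDl -eA Ax /dotv mulmx0 mxE.
  have cross (P Q : 'M[R]_(n + n)) y z : P *m Q = 0 ->
      dotv (Q *m y) (P^T *m A *m P *m z) = 0.
    move=> PQ; rewrite -!mulmxA dotv_trmx trmxK mulmxA PQ mul0mx.
    by rewrite /dotv trmx0 mul0mx mxE.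
  have sq P : P *m P = P ->
      dotv (P *m x) (P^T *m A *m P *m x) = dotv x (P^T *m A *m P *m x).
    move=> PP; rewrite -!mulmxA [LHS]dotv_trmx [RHS]dotv_trmx trmxK.
    by rewrite mulmxA PP.
  have Ppx : Pp *m x = 0.
    have := dec (Pp *m x); rewrite cross // add0r sq // => v0.
    by apply/eqP; rewrite -(dotv_compression_ge0 PpPp pos x) v0.
  have Pmx : Pm *m x = 0.
    have := dec (Pm *m x); rewrite [X in _ + X]cross // addr0 sq // => v0.
    have eN : - (Pm^T *m A *m Pm) = Pm^T *m (- A) *m Pm.
      by rewrite mulmxN mulNmx.
    move: neg; rewrite /negdef_on eN => neg.
    apply/eqP; rewrite -(dotv_compression_ge0 PmPm neg x) -eN mulNmx.
    by rewrite /dotv mulmxN mxE -/(dotv x _) v0 oppr0.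
  by rewrite -[RHS]mul1mx -sumP !mulmxDl Ppx Pmx add0r addr0.
apply/eqP; rewrite eqn_leq (mulmx0_rank_max AP0) /=.
have : (\rank (cokermx A) <= \rank P0)%N.
  have <- : P0 *m cokermx A = cokermx A.
    by apply: eq_mulmx_cV => x; rewrite -mulmxA kerP // mulmxA mulmx_coker mul0mx.
  exact: mxrankM_maxl.
by rewrite mxrank_coker leq_subLR.
Qed.

Theorem proposition4p5 (R : realType) (n : nat) (A Pm P0 Pp : 'M[R]_(n + n))
  (hA : SpS A)
  (hPm : sympl_projection Pm)
  (hP0 : sympl_projection P0)
  (hPp : sympl_projection Pp)
  (h_orth : [/\ Pm *m P0 = 0, Pm *m Pp = 0 & P0 *m Pp = 0])
  (h_sum : Pm + P0 + Pp = 1%:M)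
  (h_dec : A = Pm^T *m A *m Pm + Pp^T *m A *m Pp)
  (h_neg : negdef_on (Pm^T *m A *m Pm) (mxrange Pm))
  (h_pos : posdef_on (Pp^T *m A *m Pp) (mxrange Pp))
  (d : 'rV[R]_n) (hd : symplectic_eigenvalues A d) :
  let sp := [seq d 0 j | j <- enum 'I_n] in
  [/\ (count (fun x => x == 0) sp)%:R = (\rank P0)%:R / 2 :> rat,
      perm_eq [seq x%:C | x <- sp & x < 0]
        [seq z <- eigenvalues (iSJS (- (Pm^T *m A *m Pm))) | z < 0]
    & perm_eq [seq x%:C | x <- sp & 0 < x]
        [seq z <- eigenvalues (iSJS (Pp^T *m A *m Pp)) | 0 < z]].
Proof.
move=> sp; have [AT _] := hA; have [PmP0 PmPp P0Pp] := h_orth.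
have PmPm := sympl_projection_idem hPm; have PpPp := sympl_projection_idem hPp.
have PpPm := sympl_projection_mul_eq0 hPm hPp PmPp.
have PpP0 := sympl_projection_mul_eq0 hP0 hPp P0Pp.
have eN : - (Pm^T *m A *m Pm) = Pm^T *m (- A) *m Pm by rewrite mulmxN mulNmx.
have psdP : psdmx (Pp^T *m A *m Pp) by apply: psdmx_compression.
have psdN : psdmx (- (Pm^T *m A *m Pm)).
  rewrite eN; apply: psdmx_compression => //; last by rewrite -eN.
  by rewrite linearN /= AT.
have eA : A = Pp^T *m A *m Pp - - (Pm^T *m A *m Pm) by rewrite opprK addrC.
have orth : Pp^T *m A *m Pp *m sympJ n *m (- (Pm^T *m A *m Pm)) = 0.
  (* Moving Pp and Pm^T through J brings up Pp^T Pm^T = (Pm Pp)^T. *)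
  rewrite mulmxN -!mulmxA [Pp *m _]mulmxA (sympl_projection_comm hPp) -mulmxA.
  by rewrite [Pp^T *m _]mulmxA -trmx_mul PmPp trmx0 mul0mx !mulmx0 oppr0.
have count_sp z : count_mem z [seq x%:C | x <- sp]
    = (\sum_j ((d 0 j)%:C == z)%R)%N.
  by rewrite count_map count_map_enum.
split.
- have [M [MJM MAM]] := hd.
  have rk := rank_sympl_projection_ker PmPm PpPp
    (And4 PmP0 PpP0 PmPp PpPm) h_sum h_dec h_neg h_pos.
  rewrite (rank_williamson MJM MAM) in rk.
  have -> : \rank P0 = (count (fun x => (x == 0)%R) sp * 2)%N.
    have -> : count (fun x => x == 0) sp = (\sum_j (d 0 j == 0)%R)%N.
      exact: count_map_enum.
    have : (\sum_j (d 0 j != 0)%R + \sum_j (d 0 j == 0)%R = n)%N.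
      rewrite -big_split -[RHS]card_ord -sum1_card; apply: eq_bigr => j _ /=.
      by case: eqP.
    move: rk; lia.
  by rewrite natrM mulfK.
- have -> : [seq x%:C | x <- sp & x < 0] = [seq z <- [seq x%:C | x <- sp] | z < 0].
    rewrite [RHS]filter_map; congr ([seq _ | _ <- _]).
    by apply: eq_filter => x /=; rewrite ltcR.
  apply: perm_filter_count => z z_lt0; rewrite count_sp.
  by rewrite (count_eigenvalues_iSJS_neg psdP psdN eA orth hd z_lt0).
- have -> : [seq x%:C | x <- sp & 0 < x] = [seq z <- [seq x%:C | x <- sp] | 0 < z].
    rewrite [RHS]filter_map; congr ([seq _ | _ <- _]).
    by apply: eq_filter => x /=; rewrite ltcR.
  apply: perm_filter_count => z z_gt0; rewrite count_sp.
  by rewrite (count_eigenvalues_iSJS_pos psdP psdN eA orth hd z_gt0).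
Qed.
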